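(* Let $\mathbf{X}$ be a pure simplicial complex of dimension $k\ge -1$ and let $X\subseteq V(\mathbf{X})$. If the pair $(\mathrm{sd}\,\mathbf{X},X)$ is star decomposable in vertices, then the pair $(\mathrm{sd}\,\mathbf{X},X)$ is star decomposable (where $X$ is regarded as a subset of $V(\mathrm{sd}\,\mathbf{X})$ by identifying a vertex $v$ of $\mathbf{X}$ with the vertex $\{v\}$ of $\mathrm{sd}\,\mathbf{X}$).
   Context: Simplicial complexes are finite abstract simplicial complexes; the void complex $\emptyset$ is distinguished from $\{\emptyset\}$ (dimension $-1$). $V(\mathbf{X})$ is the vertex set; pure means all inclusion-wise maximal faces have equal dimension. For a vertex $v$: $\mathrm{lk}(v,\mathbf{X})=\{\sigma\setminus\{v\}: v\in\sigma\in\mathbf{X}\}$, $\mathrm{st}(v,\mathbf{X})=\{\sigma\in\mathbf{X}:\sigma\cup\{v\}\in\mathbf{X}\}$, and $\mathrm{st}(W',\mathbf{X})=\bigcup_{w\in W'}\mathrm{st}(w,\mathbf{X})$ for $W'\subseteq V(\mathbf{X})$. The barycentric subdivision is $\mathrm{sd}\,\mathbf{X}=\{\{\sigma_1,\dots,\sigma_n\}:\ n\ge 0,\ \sigma_i\in\mathbf{X},\ \emptyset\ne\sigma_1\subsetneq\cdots\subsetneq\sigma_n\}$. Star partition: $W\subseteq V(\mathbf{X})$ induces a star partition of $\mathbf{X}$ if $\mathbf{X}=\mathrm{st}(W,\mathbf{X})$ and no two distinct vertices of $W$ are joined by an edge of $\mathbf{X}$. For a total order $\prec$ on $W$ put $W_{\succ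 w}=\{w'\in W:w'\succ w\}$, $W_{\succeq w}=\{w'\in W: w'\succeq w\}$. For $x\in W$, $W'\subseteq W$, the overlap is $\mathbf{O}(x,W')=\mathrm{lk}(x,\mathbf{X})\cap\mathrm{st}(W',\mathbf{X})$. Star decomposability is defined by induction on $k$ for pairs $(\mathbf{X},X)$ with $\mathbf{X}$ pure $k$-dimensional, $k\ge -1$, $X\subseteq V(\mathbf{X})$; $\mathbf{X}$ is star decomposable if $(\mathbf{X},X)$ is star decomposable for some $X\subseteq V(\mathbf{X})$. For $k=-1$, $(\{\emptyset\},\emptyset)$ is star decomposable. For $k\ge 0$, $(\mathbf{X},X)$ is star decomposable if there is a nonempty $W\subseteq V(\mathbf{X})$ inducing a star partition of $\mathbf{X}$ and a total order $\prec$ on $W$ such that: (Order condition) $X=W_{\succeq w'}$ for some $w'\in W$; (Link condition) for every $w\in W$ other than the last vertex of $\prec$, there is a nonempty set $U\subseteq V(\mathrm{lk}(w,\mathbf{X}))$ such that $\mathrm{st}(U,\mathrm{lk}(w,\mathbf{X}))=\mathbf{O}(w,W_{\succ w})$ and the pair $(\mathrm{lk}(w,\mathbf{X}),U)$ is star decomposable; when $k=0$ this condition is regarded as automatically satisfied; (Last vertex condition) for the last vertex $\hat w$ of $\prec$, $\mathrm{lk}(\hat w,\mathbf{X})$ is star decomposable. Star decomposability in vertices is defined by induction on $k$ for pairs $(\mathrm{sd}\,\mathbf{X},X)$ with $\mathbf{X}$ pure $k$-dimensional, $k\ge -1$, and $X\subseteq V(\mathbf{X})$; $\mathrm{sd}\,\mathbf{X}$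 is star decomposable in vertices if $(\mathrm{sd}\,\mathbf{X},V(\mathbf{X}))$ is. For $k=-1$, $(\mathrm{sd}\{\emptyset\},\emptyset)=(\{\emptyset\},\emptyset)$ is star decomposable in vertices. For $k\ge 0$, $(\mathrm{sd}\,\mathbf{X},X)$ is star decomposable in vertices if there is a total order $\prec$ on $V(\mathbf{X})$ such that: (Order condition) $X=\{v\in V(\mathbf{X}): v\succeq w'\}$ for some $w'\in V(\mathbf{X})$; (Link condition) for every $w\in V(\mathbf{X})$ other than the last vertex of $\prec$, the pair $(\mathrm{sd}\,\mathrm{lk}(w,\mathbf{X}),\ \{v\in V(\mathrm{lk}(w,\mathbf{X})): v\succ w\})$ is star decomposable in vertices; (Last vertex condition) for the last vertex $\hat x$ of $\prec$, $\mathrm{sd}\,\mathrm{lk}(\hat x,\mathbf{X})$ is star decomposable in vertices. *)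

(* Defs.v *)
From HB Require Import structures.
From mathcomp Require Import all_boot.

Set Implicit Arguments.
Unset Strict Implicit.
Unset Printing Implicit Defensive.

(* A finite abstract simplicial complex on (some of) the points of a finType T
   is its set of faces X : {set {set T}}; set0 is the void complex, as opposed
   to [set set0], the complex of dimension -1.  Points of T need not be
   vertices of X.  Throughout, the dimension k >= -1 is represented by the
   natural number d = k + 1, the number of vertices of a k-dimensional face. *)

Section Complexes.
Variable T : finType.
Implicit Types (X : {set {set T}}) (W A U : {set T}) (v w : T).

Definition simplicial_complex X : Prop :=
  forall s t : {set T}, s \in X -> t \subset s -> t \in X.

(* Pure of dimension d - 1; the void complex is excluded. *)
Definition pure_complex (d : nat) X : Prop :=
  [/\ simplicial_complex X, X != set0
    & forall s : {set T}, maxset (mem X) s -> #|s| = d].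

Definition vertices X : {set T} := [set v | [set v] \in X].

Definition link v X : {set {set T}} := [set s :\ v | s in X & v \in s].

Definition star v X : {set {set T}} := [set s in X | v |: s \in X].

Definition stars W X : {set {set T}} := \bigcup_(w in W) star w X.

(* A chain s_1 < ... < s_n of nonempty faces is encoded as the set of its
   members: a set of nonempty faces that are pairwise comparable. *)
Definition sd X : {set {set {set T}}} :=
  [set C : {set {set T}} |
    [&& C \subset X, set0 \notin C
      & [forall s in C, forall t in C, (s \subset t) || (t \subset s)]]].

Definition star_partition W X : Prop :=
  [/\ W \subset vertices X, X = stars W X
    & {in W &, forall u v, u != v -> [set u; v] \notin X}].

(* prec is a strict total order on W; its values outside W are irrelevant. *)
Definition strict_total_order_on W (prec : rel T) : Prop :=
  [/\ {in W, forall x, ~~ prec x x},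
      {in W & &, forall x y z, prec x y -> prec y z -> prec x z}
    & {in W &, forall x y, x != y -> prec x y || prec y x}].

Definition above (prec : rel T) W w : {set T} := [set v in W | prec w v].

Definition above_eq (prec : rel T) W w : {set T} :=
  [set v in W | (v == w) || prec w v].

Definition is_last (prec : rel T) W w : bool :=
  (w \in W) && [forall v in W, (v != w) ==> prec v w].

Definition overlap X v W : {set {set T}} := link v X :&: stars W X.

(* The pair (X, A) is star decomposable, for X pure of dimension d - 1.  The
   link condition is only required in dimension d - 1 > 0, i.e. 0 < d'. *)
Fixpoint star_decomposable_pair (d : nat) X A : Prop :=
  match d with
  | 0 => X = [set set0] /\ A = set0
  | d'.+1 =>
      pure_complex d'.+1 X /\
      exists W (prec : rel T),
        [/\ W != set0 /\ star_partition W X,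
            strict_total_order_on W prec,
            exists2 w', w' \in W & A = above_eq prec W w',
            0 < d' ->
            forall w, w \in W -> ~~ is_last prec W w ->
            exists U,
              [/\ U != set0, U \subset vertices (link w X),
                  stars U (link w X) = overlap X w (above prec W w)
                & star_decomposable_pair d' (link w X) U]
          & forall w, is_last prec W w ->
            exists2 U : {set T}, U \subset vertices (link w X)
                     & star_decomposable_pair d' (link w X) U]
  end.

(* The pair (sd X, A) is star decomposable in vertices, for X pure of
   dimension d - 1 and A a set of vertices of X. *)
Fixpoint star_decomposable_in_vertices_pair (d : nat) X A : Prop :=
  match d with
  | 0 => X = [set set0] /\ A = set0
  | d'.+1 =>
      pure_complex d'.+1 X /\
      exists prec : rel T,
        [/\ strict_total_order_on (vertices X) prec,
            exists2 w', w' \in vertices X & A = above_eq prec (vertices X) w',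
            forall w, w \in vertices X -> ~~ is_last prec (vertices X) w ->
              star_decomposable_in_vertices_pair d' (link w X)
                (above prec (vertices (link w X)) w)
          & forall w, is_last prec (vertices X) w ->
              star_decomposable_in_vertices_pair d' (link w X)
                (vertices (link w X))]
  end.

End Complexes.

(* Main.v *)
Require Import Defs.
From HB Require Import structures.
From mathcomp Require Import all_boot.

Set Implicit Arguments.
Unset Strict Implicit.
Unset Printing Implicit Defensive.

(* The singletons [set v] induce a star partition of [sd X]: the least member
   of a chain contains some v, and [set v] can then be added to the chain.
   Order them as the vertices v.  The link of [set w] in [sd X] consists of the
   chains of faces properly containing w, hence is a copy of [sd (link w X)],
   so one inducts on the dimension.  Instead of transporting the conclusion
   along this isomorphism, the induction is carried out for the complex
   [sd_over t Y] of chains of sets x properly containing t with x \ t in Y;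
   then the link of [w |: t] is literally [sd_over (w |: t) (link w Y)]. *)

(** * Transport of a total order along an injection *)

Section ImageOrder.
Variables (T1 T2 : finType) (f : T1 -> T2) (W : {set T1}) (prec : rel T1).
Hypothesis f_inj : {in W &, injective f}.

(** Phrased through preimages in [W], because [f] is injective only on [W] and the result has to be
    a relation on all of [T2]; it is false outside [f @: W]. *)
Definition image_rel : rel T2 := fun x y =>
  [exists u in W, exists v in W, [&& f u == x, f v == y & prec u v]].

Lemma image_relE : {in W &, forall u v, image_rel (f u) (f v) = prec u v}.
Proof.
move=> u v uW vW; apply/exists_inP/idP => [[a aW]|uv].
  by case/exists_inP=> b bW /and3P[/eqP/f_inj-> // /eqP/f_inj-> //].
by exists u => //; apply/exists_inP; exists v; rewrite // !eqxx.
Qed.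

Lemma image_strict_total_order :
  strict_total_order_on W prec -> strict_total_order_on (f @: W) image_rel.
Proof.
case=> irr tr tot; split.
- by move=> _ /imsetP[x xW ->]; rewrite image_relE ?irr.
- move=> _ _ _ /imsetP[x xW ->] /imsetP[y yW ->] /imsetP[z zW ->].
  by rewrite !image_relE //; apply: tr.
- move=> _ _ /imsetP[x xW ->] /imsetP[y yW ->] fxy; rewrite !image_relE //.
  by apply: tot => //; apply: contraNneq fxy => ->.
Qed.

Lemma image_above w :
  w \in W -> above image_rel (f @: W) (f w) = f @: above prec W w.
Proof.
move=> wW; apply/setP=> x; rewrite inE; apply/andP/imsetP.
  case=> /imsetP[v vW ->]; rewrite image_relE // => wv.
  by exists v; rewrite // inE vW.
by case=> v /[!inE] /andP[vW wv] ->; rewrite image_relE // imset_f.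
Qed.

Lemma image_above_eq w :
  w \in W -> above_eq image_rel (f @: W) (f w) = f @: above_eq prec W w.
Proof.
move=> wW; apply/setP=> x; rewrite inE; apply/andP/imsetP.
  case=> /imsetP[v vW ->]; rewrite image_relE // (inj_in_eq f_inj) // => wv.
  by exists v; rewrite // inE vW.
case=> v /[!inE] /andP[vW wv] ->.
by rewrite image_relE // (inj_in_eq f_inj) // imset_f.
Qed.

Lemma image_is_last w :
  w \in W -> is_last image_rel (f @: W) (f w) = is_last prec W w.
Proof.
move=> wW; rewrite /is_last imset_f // wW /=; apply/forall_inP/forall_inP.
  move=> last_w v vW; have := last_w _ (imset_f f vW).
  by rewrite (inj_in_eq f_inj) // image_relE.
move=> last_w _ /imsetP[v vW ->].
by rewrite (inj_in_eq f_inj) // image_relE // last_w.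
Qed.

End ImageOrder.

(** * Links, vertices and purity *)

Section Complexes.
Variable T : finType.
Implicit Types (X : {set {set T}}) (s W : {set T}) (v w : T).

Lemma in_link v X s : (s \in link v X) = (v \notin s) && (v |: s \in X).
Proof.
apply/imsetP/andP=> [[a /setIdP[aX va] ->]|[vs vsX]].
  by rewrite setD11 setD1K.
by exists (v |: s); rewrite ?inE ?vsX ?eqxx // setU1K.
Qed.

Lemma link_simplicial_complex v X :
  simplicial_complex X -> simplicial_complex (link v X).
Proof.
move=> scX s t; rewrite !in_link => /andP[vs vsX] ts; apply/andP; split.
  by apply: contra vs; apply: (subsetP ts).
by apply: scX vsX _; apply: setUS.
Qed.

Lemma vertices_link v X :
  simplicial_complex X -> vertices (link v X) \subset vertices X.
Proof.
move=> scX; apply/subsetP=> u; rewrite !inE in_link => /andP[_ vuX].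
by apply: scX vuX _; apply: subsetUr.
Qed.

Lemma pure_vertices_neq0 d X : pure_complex d.+1 X -> vertices X != set0.
Proof.
case=> scX /set0Pn[s0 s0X] pX.
have [s smax _] := maxset_exists (s0X : mem X s0).
have /card_gt0P[v vs] : 0 < #|s| by rewrite (pX _ smax).
apply/set0Pn; exists v; rewrite inE; apply: scX (maxsetp smax) _.
by rewrite sub1set.
Qed.

(** Adding [v] to a maximal face of the link produces a maximal face of [X], which has exactly one
    more point. *)
Lemma link_pure d v X :
  pure_complex d.+1 X -> v \in vertices X -> pure_complex d (link v X).
Proof.
case=> scX _ pX; rewrite inE => vX; split.
- exact: link_simplicial_complex.
- by apply/set0Pn; exists set0; rewrite in_link inE setU0.
move=> s /maxsetP[]; rewrite [mem _ _]in_link => /andP[vs vsX] smax.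
suff /pX : maxset (mem X) (v |: s) by rewrite cardsU1 vs => -[].
apply/maxsetP; split=> // t tX vst.
have vt : v \in t by rewrite (subsetP vst) ?setU11.
rewrite -(setD1K vt); congr (v |: _); apply: smax.
  by rewrite [mem _ _]in_link setD11 setD1K.
by rewrite subsetD1 vs (subset_trans _ vst) // subsetUr.
Qed.

(** A maximal face lies in the star of some [w] in [W], so by maximality it contains [w]; without
    [w] it is a maximal face of the link of [w]. This lets purity be proved by induction through
    links. *)
Lemma stars_pure d W X :
    simplicial_complex X -> X != set0 -> X = stars W X ->
    {in W, forall w, pure_complex d (link w X)} ->
  pure_complex d.+1 X.
Proof.
move=> scX X0 XW pW; split=> // s /maxsetP[/[dup] sX + smax].
rewrite [mem _ _](_ : _ = (s \in X)) // {1}XW => /bigcupP[w wW].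
case/setIdP=> _ wsX.
have ws : w \in s by rewrite -(smax _ wsX (subsetUr _ _)) setU11.
have [_ _ pw] := pW w wW; rewrite (cardsD1 w) ws; congr _.+1; apply: pw.
apply/maxsetP; split; first by rewrite [mem _ _]in_link setD11 setD1K.
move=> t; rewrite [mem _ _]in_link => /andP[wt wtX] st.
by rewrite -(smax _ wtX) ?setU1K // -(setD1K ws) setUS.
Qed.

(** The order condition makes [A] an up-set containing its own threshold. This supplies the nonempty
    [U] that the link condition asks for in positive dimension. *)
Lemma in_vertices_pair_neq0 d X (A : {set T}) :
  star_decomposable_in_vertices_pair d.+1 X A -> A != set0.
Proof.
case=> _ [prec [_ [w wX ->] _ _]].
by apply/set0Pn; exists w; rewrite inE wX eqxx.
Qed.

End Complexes.

(** * Order complexes of families of sets, and the subdivision *)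

Section Subdivision.
Variable T : finType.
Implicit Types (X : {set {set T}}) (s t x : {set T}) (v w : T).

(** The order complex of [P] under inclusion. Unlike in [sd], the empty set is a legitimate member
    of a chain if it belongs to [P]. *)
Definition chains (P : {set {set T}}) : {set {set {set T}}} :=
  [set C : {set {set T}} | (C \subset P)
    && [forall s in C, forall t in C, (s \subset t) || (t \subset s)]].

Definition comparable_in (P : {set {set T}}) s : {set {set T}} :=
  [set x in P | (s \subset x) || (x \subset s)].

Lemma chainsP (P C : {set {set T}}) :
  reflect [/\ {subset C <= P}
            & {in C &, forall s t, (s \subset t) || (t \subset s)}]
          (C \in chains P).
Proof.
rewrite inE; apply: (iffP andP) => -[/subsetP CP cmpC]; split=> //.
  by move=> s t sC tC; move/forall_inP/(_ s sC)/forall_inP: cmpC; apply.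
by apply/forall_inP=> s sC; apply/forall_inP=> t tC; apply: cmpC.
Qed.

Lemma chains_simplicial_complex (P : {set {set T}}) :
  simplicial_complex (chains P).
Proof.
move=> C D /chainsP[CP cmpC] /subsetP DC; apply/chainsP; split.
  by move=> x /DC/CP.
by move=> x y /DC xC /DC yC; apply: cmpC.
Qed.

Lemma set0_chains (P : {set {set T}}) : set0 \in chains P.
Proof. by apply/chainsP; split=> [x|x y]; rewrite inE. Qed.

(** Vertices, links and stars are all tested by adjoining a point to a face; this turns each such
    test into one of comparability with [s]. *)
Lemma setU1_chains (P C : {set {set T}}) s :
  (s |: C \in chains P)
    = [&& s \in P, C \in chains P & C \subset comparable_in P s].
Proof.
apply/idP/and3P=> [sC|[sP /chainsP[CP cmpC] /subsetP Cs]].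
  have [sCP cmp] := chainsP _ _ sC; split; first exact/sCP/setU11.
    by apply: chains_simplicial_complex sC _; apply: subsetUr.
  by apply/subsetP=> x xC; rewrite inE sCP ?cmp ?setU11 ?setU1r.
apply/chainsP; split=> [x /setU1P[->|/CP] //|x y].
case/setU1P=> [->|xC] /setU1P[->|yC]; rewrite ?subxx //; last exact: cmpC.
  by have /[!inE] /andP[] := Cs _ yC.
by have /[!inE] /andP[_] := Cs _ xC; rewrite orbC.
Qed.

Lemma vertices_chains (P : {set {set T}}) : vertices (chains P) = P.
Proof.
apply/setP=> s; rewrite inE -[[set s]]setU0 setU1_chains set0_chains sub0set.
by rewrite !andbT.
Qed.

Lemma link_chains (P : {set {set T}}) s :
  s \in P -> link s (chains P) = chains (comparable_in P s :\ s).
Proof.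
move=> sP; apply/setP=> C; rewrite in_link setU1_chains sP /=.
apply/and3P/chainsP=> [[sC /chainsP[_ cmpC] /subsetP Cs]|[Cs cmpC]]; split=> //.
- by move=> x xC; rewrite in_setD1 Cs // andbT; apply: contraNneq sC => <-.
- by apply/negP=> /Cs; rewrite setD11.
- by apply/chainsP; split=> // x /Cs; rewrite !inE => /and3P[].
- by apply/subsetP=> x /Cs /setD1P[].
Qed.

(** When the faces of [X] are disjoint from [s], these are the unions of [s] with the nonempty faces
    of [X]. Properness of the inclusion is what excludes the empty face. *)
Definition faces_over s X : {set {set T}} :=
  [set x : {set T} | (s \proper x) && (x :\: s \in X)].

Definition sd_over s X : {set {set {set T}}} := chains (faces_over s X).

Lemma sd_over_set0 X : sd_over set0 X = sd X.
Proof.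
apply/setP=> C; rewrite !inE andbA; congr (_ && _).
apply/subsetP/andP=> [CX|[/subsetP CX C0] x xC].
  split; first by apply/subsetP=> x /CX; rewrite inE setD0 => /andP[].
  by apply/negP=> /CX; rewrite inE properxx.
by rewrite inE setD0 CX // proper0 andbT; apply: contraNneq C0 => <-.
Qed.

(** * Links and stars of the vertices [v |: t] *)

Section Over.
Variables (t : {set T}) (X : {set {set T}}).
Hypothesis scX : simplicial_complex X.
Hypothesis tX : {in X, forall s, [disjoint t & s]}.

Lemma vertex_notin v : v \in vertices X -> v \notin t.
Proof. by rewrite inE => /tX; rewrite disjoint_sym disjoints1. Qed.

Lemma setU1_over_inj : {in vertices X &, injective (fun v => v |: t)}.
Proof.
move=> u v /vertex_notin ut _ e; have : u \in v |: t by rewrite -e setU11.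
by case/setU1P=> // ut'; rewrite ut' in ut.
Qed.

Lemma setU1_faces_over v : v \in vertices X -> v |: t \in faces_over t X.
Proof.
move=> vX; have vt := vertex_notin vX; rewrite inE properUr ?sub1set //.
rewrite (_ : _ :\: t = [set v]); first by rewrite inE in vX.
apply/setP=> x; rewrite !inE; case: eqP => [->|_]; first by rewrite vt.
by case: (x \in t).
Qed.

Lemma faces_over_vertex x v :
  x \in faces_over t X -> v \in x -> v \notin t -> v \in vertices X.
Proof.
rewrite !inE => /andP[_ xX] vx vt; apply: scX xX _.
by rewrite sub1set inE vt.
Qed.

(** No set lies strictly between [t] and [v |: t], so [v |: t] is minimal in [faces_over t X]. Hence
    being comparable with [v |: t] means containing it, which drives the descriptions of links,
    stars and the star partition. *)
Lemma faces_over_setU1_sub x v :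
    v \in vertices X -> x \in faces_over t X -> x \subset v |: t ->
  x = v |: t.
Proof.
move=> vX /[!inE] /andP[tx _] xv; apply/eqP; rewrite eqEsubset xv.
have [tsx [u ux ut]] := properP tx.
rewrite subUset tsx sub1set andbT.
by have /setU1P[<- //|uT] := subsetP xv u ux; rewrite uT in ut.
Qed.

Lemma link_faces_over v :
    v \in vertices X ->
  comparable_in (faces_over t X) (v |: t) :\ (v |: t)
    = faces_over (v |: t) (link v X).
Proof.
move=> vX; have vt := vertex_notin vX.
(* Matches the two face conditions: a face of the link together with [v] is what remains of [x] once
   only [t] is removed. *)
have sdE (x : {set T}) : v |: t \subset x -> v |: (x :\: (v |: t)) = x :\: t.
  rewrite subUset sub1set => /andP[vx _]; apply/setP=> y; rewrite !inE.
  by case: eqP => [->|_]; rewrite ?vx ?vt.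
apply/setP=> x; rewrite [RHS]inE in_link.
apply/setD1P/andP=> [[xv /setIdP[xP cmp]]|[vx /andP[_]]].
  have vx : v |: t \subset x.
    case/orP: cmp => // /(faces_over_setU1_sub vX xP) e.
    by rewrite e eqxx in xv.
  rewrite sdE //; move: xP; rewrite !inE eqxx => /andP[_ ->].
  by rewrite properEneq vx eq_sym xv.
have svx := proper_sub vx.
rewrite sdE // => xX; split.
  by apply: contraTneq vx => ->; rewrite properxx.
rewrite !inE svx xX !andbT; apply: sub_proper_trans vx.
exact: subsetUr.
Qed.

Lemma link_sd_over v :
  v \in vertices X -> link (v |: t) (sd_over t X) = sd_over (v |: t) (link v X).
Proof.
by move=> vX; rewrite link_chains ?setU1_faces_over // link_faces_over.
Qed.

Lemma star_sd_over v C :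
    v \in vertices X ->
  (C \in star (v |: t) (sd_over t X))
    = (C \in sd_over t X) && [forall x in C, v |: t \subset x].
Proof.
move=> vX; rewrite inE setU1_chains setU1_faces_over // andbA andbT andbA andbb.
apply: andb_id2l => /chainsP[CP _]; apply/subsetP/forall_inP=> Cv x xC.
  have /setIdP[xP /orP[//|xv]] := Cv x xC.
  by rewrite (faces_over_setU1_sub vX xP xv).
by rewrite inE CP // Cv.
Qed.

End Over.

(** * Purity, star partition and overlaps of [sd_over t X] *)

Lemma link_disjoint t X v :
    {in X, forall s, [disjoint t & s]} ->
  {in link v X, forall s, [disjoint v |: t & s]}.
Proof.
move=> tX s; rewrite in_link => /andP[vs /tX].
rewrite !disjoints_subset subUset sub1set inE vs setCU => /subset_trans-> //.
exact: subsetIr.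
Qed.

(** A member of least cardinality is comparable with every other member, hence contained in it. *)
Lemma chain_least (P C : {set {set T}}) :
    C \in chains P -> C != set0 ->
  exists2 s, s \in C & {in C, forall x, s \subset x}.
Proof.
case/chainsP=> _ cmpC /set0Pn[s0 s0C].
have [s sC smin] := arg_minnP (fun s : {set T} => #|s|) s0C.
exists s => // x xC; case/orP: (cmpC _ _ sC xC) => // xs.
by have /eqP <- : x == s by rewrite eqEcard xs smin.
Qed.

Lemma sd_over_stars d t X :
    pure_complex d.+1 X -> {in X, forall s, [disjoint t & s]} ->
  sd_over t X = stars [set v |: t | v in vertices X] (sd_over t X).
Proof.
move=> pX tX; have [scX _ _] := pX.
apply/setP=> C; apply/idP/bigcupP=> [CX|[x _ /setIdP[] //]].
suff [v vX Cv] : exists2 v, v \in vertices X & {in C, forall x, v |: t \subset x}.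
  exists (v |: t); first exact: imset_f.
  by rewrite (star_sd_over tX) // CX; apply/forall_inP.
(* The empty chain has no least member, but it lies in every star, so any vertex serves. *)
have [C0|] := eqVneq C set0.
  have /set0Pn[v vX] := pure_vertices_neq0 pX.
  by exists v => // x; rewrite C0 inE.
case/(chain_least CX)=> s sC sleast.
have [/(_ s sC) sP _] := chainsP _ _ CX.
have /properP[ts [v vs vt]] : t \proper s by move: sP; rewrite inE => /andP[].
exists v; first exact: (faces_over_vertex scX sP).
by move=> x /sleast; apply: subset_trans; rewrite subUset sub1set vs.
Qed.

Lemma sd_over_pure d t X :
    pure_complex d X -> {in X, forall s, [disjoint t & s]} ->
  pure_complex d (sd_over t X).
Proof.
elim: d t X => [|d IH] t X pX tX.
  (* In dimension -1 the only face is empty, so no set qualifies for [faces_over t X] and the only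
     chain is the empty one. *)
  have X0 s : s \in X -> s = set0.
    move=> sX; have [u umax su] := maxset_exists (sX : mem X s).
    case: pX => _ _ /(_ u umax)/cards0_eq u0.
    by apply/eqP; rewrite -subset0 -u0.
  have P0 : faces_over t X = set0.
    apply/setP=> x; rewrite !inE; apply/andP=> -[tx /X0/eqP].
    by rewrite setD_eq0 => xt; rewrite properE xt andbF in tx.
  split; first exact: chains_simplicial_complex.
    by apply/set0Pn; exists set0; apply: set0_chains.
  move=> C /maxsetp/chainsP[CP _]; apply: eq_card0 => x.
  by apply/negP=> /CP; rewrite P0 inE.
apply: (stars_pure (@chains_simplicial_complex _) _ (sd_over_stars pX tX)).
  by apply/set0Pn; exists set0; apply: set0_chains.
move=> _ /imsetP[v vX ->]; rewrite (link_sd_over tX) //.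
by apply: IH; [apply: link_pure | apply: link_disjoint].
Qed.

Lemma sd_over_star_partition d t X :
    pure_complex d.+1 X -> {in X, forall s, [disjoint t & s]} ->
  star_partition [set v |: t | v in vertices X] (sd_over t X).
Proof.
move=> pX tX; split; last 1 first.
(* An edge would make [u |: t] and [v |: t] comparable; both are minimal, so they would coincide. *)
- move=> _ _ /imsetP[u uX ->] /imsetP[v vX ->] uv.
  apply: contra uv => /chainsP[_ /(_ (u |: t) (v |: t))].
  rewrite !inE !eqxx !orbT => /(_ isT isT)/orP[]; last rewrite eq_sym.
    by move/(faces_over_setU1_sub vX (setU1_faces_over tX uX)) ->.
  by move/(faces_over_setU1_sub uX (setU1_faces_over tX vX)) ->.
- apply/subsetP=> _ /imsetP[v vX ->].
  by rewrite vertices_chains setU1_faces_over.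
- exact: sd_over_stars pX tX.
Qed.

(** The members of a chain in the link of [w |: t] already contain [w |: t], so containing [v |: t]
    amounts to containing [v |: (w |: t)]. The real content is that such a [v] is a vertex of
    [link w X]. The empty chain lies in the overlap as soon as something follows [w], which is why
    the left-hand index set is assumed nonempty. *)
Lemma overlap_sd_over t X (prec : rel T) w :
    simplicial_complex X -> {in X, forall s, [disjoint t & s]} ->
    strict_total_order_on (vertices X) prec -> w \in vertices X ->
    above prec (vertices (link w X)) w != set0 ->
  stars [set v |: (w |: t) | v in above prec (vertices (link w X)) w]
        (sd_over (w |: t) (link w X))
    = overlap (sd_over t X) (w |: t)
        [set v |: t | v in above prec (vertices X) w].
Proof.
move=> scX tX [irr _ _] wX.
have twX := link_disjoint tX; set L := above prec _ w => L0.
have vLX u : u \in vertices (link w X) -> u \in vertices X.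
  exact/subsetP/vertices_link.
rewrite /overlap (link_sd_over tX) //; apply/setP=> C; rewrite inE.
apply/bigcupP/andP.
  case=> _ /imsetP[v /setIdP[vL wv] ->]; rewrite (star_sd_over (twX _)) //.
  case/andP=> CL /forall_inP Cv; split=> //; apply/bigcupP.
  exists (v |: t); first by apply: imset_f; rewrite inE vLX.
  rewrite (star_sd_over tX) ?vLX //; apply/andP; split.
    move: CL; rewrite -(link_sd_over tX) // in_link => /andP[_].
    by move/chains_simplicial_complex; apply; apply: subsetUr.
  apply/forall_inP=> x /Cv; apply: subset_trans; apply: setUS.
  exact: subsetUr.
case=> CL /bigcupP[_ /imsetP[v /setIdP[vX wv] ->]].
rewrite (star_sd_over tX) // => /andP[_ /forall_inP Cv].
have [CP _] := chainsP _ _ CL.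
suff [u uL Cu] : exists2 u, u \in L & {in C, forall x, u |: (w |: t) \subset x}.
  exists (u |: (w |: t)); first exact: imset_f.
  rewrite (star_sd_over (twX _)); last by case/setIdP: uL.
  by rewrite CL; apply/forall_inP.
have [->|/set0Pn[s sC]] := eqVneq C set0.
  by have /set0Pn[u uL] := L0; exists u => // x; rewrite inE.
have wtx x : x \in C -> w |: t \subset x.
  by move/CP; rewrite inE => /andP[/proper_sub].
exists v; last first.
  by move=> x xC; rewrite subUset wtx // (subset_trans _ (Cv x xC)) ?subsetUl.
(* The face [s :\: (w |: t)] of [link w X] contains [v]: [v] is in [s], differs from [w] by
   irreflexivity, and is outside [t] as a vertex of [X]. So [v] is a vertex of that link. *)
rewrite inE wv andbT; have sP := CP _ sC; move: (sP); rewrite inE => /andP[_ sL].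
have vs : v \in s by rewrite (subsetP (Cv s sC)) ?setU11.
rewrite inE; apply: (link_simplicial_complex scX) sL _.
rewrite sub1set !inE vs (negbTE (vertex_notin tX vX)) orbF !andbT.
by apply: contraTneq wv => ->; apply: irr.
Qed.

(** * The induction on the dimension, for all base sets [t] at once *)

Lemma sd_over_star_decomposable d t X (A : {set T}) :
    pure_complex d X -> {in X, forall s, [disjoint t & s]} ->
    star_decomposable_in_vertices_pair d X A ->
  star_decomposable_pair d (sd_over t X) [set v |: t | v in A].
Proof.
elim: d t X A => [|d IH] t X A pX tX.
  case=> X0 ->; split; last exact: imset0.
  apply/setP=> C; rewrite [RHS]inE; apply/idP/eqP=> [/chainsP[CP _]|->].
    apply/setP=> x; rewrite inE; apply/negP=> /CP; rewrite X0 !inE.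
    by rewrite setD_eq0 properE; case: (x \subset t); rewrite ?andbF.
  exact: set0_chains.
case=> _ [prec [ord [w' w'X ->] lnk lst]]; split; first exact: sd_over_pure.
have [scX _ _] := pX.
have inj := @setU1_over_inj t X tX.
have lnk_IH w B : w \in vertices X ->
    star_decomposable_in_vertices_pair d (link w X) B ->
    star_decomposable_pair d (link (w |: t) (sd_over t X))
      [set v |: (w |: t) | v in B].
  move=> wX; rewrite (link_sd_over tX) //; apply: IH.
    exact: link_pure.
  exact: link_disjoint.
have subL w (B : {set T}) : w \in vertices X -> B \subset vertices (link w X) ->
    [set v |: (w |: t) | v in B]
      \subset vertices (link (w |: t) (sd_over t X)).
  move=> wX /subsetP BL; rewrite (link_sd_over tX) // vertices_chains.
  apply/subsetP=> _ /imsetP[v /BL vL ->].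
  by apply: setU1_faces_over => //; apply: link_disjoint.
exists [set v |: t | v in vertices X].
exists (image_rel (fun v => v |: t) (vertices X) prec); split.
- split; last exact: sd_over_star_partition pX tX.
  by rewrite imset_eq0; apply: pure_vertices_neq0 pX.
- exact: image_strict_total_order.
- by exists (w' |: t); [apply: imset_f | rewrite image_above_eq].
- move=> d_gt0 _ /imsetP[w wX ->]; rewrite image_is_last // => /(lnk w wX) dec.
  (* Since [0 < d], the link is again in the successor case of the definition, where the order
     condition forces nonemptiness. *)
  have L0 : above prec (vertices (link w X)) w != set0.
    by case: d d_gt0 dec {IH pX lnk lst lnk_IH} => // d _;
      apply: in_vertices_pair_neq0.
  exists [set v |: (w |: t) | v in above prec (vertices (link w X)) w]; split.
  + by rewrite imset_eq0.
  + by apply: subL => //; apply/subsetP=> v /setIdP[].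
  + rewrite image_above // (link_sd_over tX) //.
    exact: overlap_sd_over scX tX ord wX L0.
  + exact: lnk_IH.
- move=> x lst_x; have /imsetP[w wX xE] : x \in [set v |: t | v in vertices X].
    by case/andP: lst_x.
  move: lst_x; rewrite xE image_is_last // => /lst dec.
  (* For the last vertex any [U] is allowed; the hypothesis provides the pair with all vertices of
     the link. *)
  exists [set v |: (w |: t) | v in vertices (link w X)].
    exact: subL.
  exact: lnk_IH.
Qed.

End Subdivision.

Theorem proposition11 (T : finType) (d : nat) (X : {set {set T}}) (A : {set T})
    (hX : pure_complex d X) (hA : A \subset vertices X) :
  star_decomposable_in_vertices_pair d X A ->
  star_decomposable_pair d (sd X) [set [set v] | v in A].
Proof.
rewrite -sd_over_set0 => dec.
rewrite (_ : [set [set v] | v in A] = [set v |: set0 | v in A]).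
  apply: sd_over_star_decomposable => // s _.
  by rewrite disjoints_subset sub0set.
by apply: eq_imset => v; rewrite setU0.
Qed.
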